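(* Let $\langle\gamma_t\rangle$ be a one-parameter hyperbolic group with Margulis invariant $\alpha>0$ and generalized Margulis invariant $\mu$. Let $k>0$ and let $p\in\mathcal{S}_k$. The $\langle\gamma_t\rangle$-orbit through $p$ admits a one-parameter crooked foliation with directors in $(g^0)^\perp$ if and only if $k\le\mu$.
   Context: $\mathsf{V}=\mathbb{R}^3$ with scalar product $\mathsf{x}\cdot\mathsf{y}=x_1y_1+x_2y_2-x_3y_3$; $\mathsf{E}$ is the affine space modeled on $\mathsf{V}$. A nonzero vector $\mathsf{v}$ is timelike, null, or spacelike if $\mathsf{v}\cdot\mathsf{v}$ is $<0$, $=0$, $>0$; unit-spacelike if $\mathsf{v}\cdot\mathsf{v}=1$. $\mathsf{v}^\perp$ is the orthogonal of $\mathsf{v}$ for this product. For $\mathsf{u}$ spacelike, $\mathsf{u}^-,\mathsf{u}^+$ are the null vectors with third coordinate $1$ such that $\mathsf{u}^\perp=\langle \mathsf{u}^-,\mathsf{u}^+\rangle$ and $\det[\mathsf{u}\ \mathsf{u}^-\ \mathsf{u}^+]>0$. The crooked plane $\mathcal{C}(p,\mathsf{u})$ with vertex $p\in\mathsf{E}$ and (spacelike) director $\mathsf{u}$ is the union of the stem $p+\{\mathsf{x}\in\mathsf{u}^\perp:\mathsf{x}\cdot\mathsf{x}\le 0\}$ and the two wings $p+\{\mathsf{x}\in(\mathsf{u}^+)^\perp \text{ spacelike}:\mathsf{x}^+=\mathsf{u}^+\}$ and $p+\{\mathsf{x}\in(\mathsf{u}^-)^\perp\text{ spacelike}:\mathsf{x}^+=\mathsf{u}^-\}$.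 A crooked foliation is a family $\{\mathcal{C}(p_t,\mathsf{u}_t)\}_{t\in\mathbb{R}}$ of pairwise disjoint crooked planes, where $(\mathsf{u}_t)$ is a continuous curve of spacelike vectors and $(p_t)$ is a regular curve (smooth, nowhere zero tangent) in $\mathsf{E}$. One-parameter hyperbolic group: a one-parameter subgroup $\langle\gamma_t\rangle_{t\in\mathbb{R}}$, $\gamma_t=\exp(tX)$, of the group of orientation-preserving affine isometries of $\mathsf{E}$, whose linear parts $g_t$ are hyperbolic for $t\ne0$ (three distinct real eigenvalues). Put $\gamma=\gamma_1$, $g=g_1$, and let $e^{-l}<1<e^{l}$ ($l>0$) be the eigenvalues of $g$. Let $g^{\pm}$ be the $e^{\pm l}$-eigenvector of $g$ with third coordinate $1$, and $g^0$ the unit-spacelike $1$-eigenvector with $\det[g^0\ g^-\ g^+]>0$. After a translation of the origin, the translational part of $\gamma$ is $\alpha g^0$ with $\alpha\in\mathbb{R}$; $\alpha$ is the Margulis invariant of $\gamma$. It is assumed throughout that $\alpha>0$. Then $\gamma$ has a unique invariant line $l_\gamma$, on which it acts by $x\mapsto x+\alpha g^0$. The generalized Margulis invariant is $\mu=\alpha/l$ (computed from any $\gamma_t$, $t\neq0$, it takes the same value). Every $p\in\mathsf{E}$ can be written uniquely as $p=q+\mathsf{x}$ with $q\in l_\gamma$ and $\mathsf{x}\in(g^0)^\perp$. For $k>0$, $\mathcal{S}_k=\{p\in\mathsf{E}:\mathsf{x}\cdot\mathsf{x}=k^2\}$. The orbit through $p$ admits a one-parameter crooked foliation with directors in $(g^0)^\perp$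 if there is a unit-spacelike vector $\mathsf{u}\in(g^0)^\perp$ such that $\{\mathcal{C}(\gamma_t(p),g_t(\mathsf{u}))\}_{t\in\mathbb{R}}$ is a crooked foliation. *)

(* Defs.v *)
From HB Require Import structures.
From mathcomp Require Import all_boot all_order all_algebra.
From mathcomp Require Import all_classical all_reals all_analysis.

Set Implicit Arguments.
Unset Strict Implicit.
Unset Printing Implicit Defensive.

Import Order.TTheory GRing.Theory Num.Theory numFieldNormedType.Exports.

Local Open Scope classical_set_scope.
Local Open Scope ring_scope.

(* The vector space V and the affine space E modeled on it are both
   represented by 'cV[R]_3; no normalization of the origin of E is made. *)

Section Lorentz.
Variable R : realType.
Local Notation V := 'cV[R]_3.
Implicit Types u v w x y p : V.

Definition ldot x y : R := x 0 0 * y 0 0 + x 1 0 * y 1 0 - x 2 0 * y 2 0.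

Definition null v : Prop := v != 0 /\ ldot v v = 0.
Definition spacelike v : Prop := v != 0 /\ 0 < ldot v v.
Definition unit_spacelike v : Prop := ldot v v = 1.

Definition perp v : set V := [set x | ldot x v = 0].

Definition span2 v w : set V := [set x | exists a b : R, x = a *: v + b *: w].

Definition det3 u v w : R :=
  \det (\matrix_(i < 3, j < 3) (tnth [tuple u; v; w] j) i 0).

Definition is_null_pair u (n : V * V) : Prop :=
  [/\ null n.1 /\ n.1 2 0 = 1,
      null n.2 /\ n.2 2 0 = 1,
      perp u = span2 n.1 n.2 &
      0 < det3 u n.1 n.2].

(* For spacelike u exactly one pair satisfies is_null_pair u; the default
   value (0, 0) is irrelevant. *)
Definition null_pair u : V * V := xget (0, 0) (is_null_pair u).
Definition uminus u : V := (null_pair u).1.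
Definition uplus u : V := (null_pair u).2.

Definition stem u : set V := [set x | perp u x /\ ldot x x <= 0].
Definition wing_plus u : set V :=
  [set x | [/\ perp (uplus u) x, spacelike x & uplus x = uplus u]].
Definition wing_minus u : set V :=
  [set x | [/\ perp (uminus u) x, spacelike x & uplus x = uminus u]].

Definition crooked_plane p u : set V :=
  [set p + x | x in stem u `|` wing_plus u `|` wing_minus u].

Definition regular_curve (c : R -> V) : Prop :=
  (forall (n : nat) (t : R), derivable (derive1n n c) t 1) /\
  (forall t : R, derive1 c t != 0).

Definition crooked_foliation (c d : R -> V) : Prop :=
  [/\ regular_curve c,
      continuous d,
      (forall t : R, spacelike (d t)) &
      forall s t : R, s != t ->
        crooked_plane (c s) (d s) `&` crooked_plane (c t) (d t) = set0].

Record affine_map := AffineMap { lin : 'M[R]_3 ; trans : V }.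

Definition act (f : affine_map) p : V := lin f *m p + trans f.

Definition orientation_preserving_isometry (f : affine_map) : Prop :=
  (forall x y : V, ldot (lin f *m x) (lin f *m y) = ldot x y) /\
  0 < \det (lin f).

Definition homogeneous (f : affine_map) : 'M[R]_(3 + 1) :=
  block_mx (lin f) (trans f) 0 1%:M.

Definition expmx (n : nat) (A : 'M[R]_n.+1) : 'M[R]_n.+1 :=
  limn (series (fun k : nat => (k`!%:R : R)^-1 *: A ^+ k)).

(* gamma t = exp (t X), where X ranges over the Lie algebra of the affine
   group, realized by the matrices [A b; 0 0]. *)
Definition one_parameter_subgroup (gamma : R -> affine_map) : Prop :=
  exists (A : 'M[R]_3) (b : V), forall t : R,
    homogeneous (gamma t) = @expmx 3 (t *: block_mx A b 0 0).

(* eigenvalue is defined by row vectors, but a square matrix and its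
   transpose have the same eigenvalues. *)
Definition hyperbolic (g : 'M[R]_3) : Prop :=
  exists a b c : R, uniq [:: a; b; c] /\ all (eigenvalue g) [:: a; b; c].

Definition one_parameter_hyperbolic_group (gamma : R -> affine_map) : Prop :=
  [/\ one_parameter_subgroup gamma,
      (forall t : R, orientation_preserving_isometry (gamma t)) &
      forall t : R, t != 0 -> hyperbolic (lin (gamma t))].

(* gm, gp, g0 stand for g^-, g^+, g^0; the eigenvectors gm and gp are nonzero
   by the normalization of their third coordinate. *)
Definition hyperbolic_frame (g : 'M[R]_3) (l : R) (gm gp g0 : V) : Prop :=
  [/\ 0 < l,
      g *m gm = expR (- l) *: gm /\ gm 2 0 = 1,
      g *m gp = expR l *: gp /\ gp 2 0 = 1,
      g *m g0 = g0 /\ unit_spacelike g0 &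
      0 < det3 g0 gm gp].

(* Translating the origin to o turns the translational part of f into
   f o - o. *)
Definition is_margulis_invariant (f : affine_map) (g0 : V) (alpha : R) : Prop :=
  exists o : V, act f o - o = alpha *: g0.

Definition generalized_margulis_invariant (alpha l : R) : R := alpha / l.

Definition affine_line (L : set V) : Prop :=
  exists o v : V, v != 0 /\ L = [set o + s *: v | s in [set: R]].

Definition invariant_line (f : affine_map) (L : set V) : Prop :=
  affine_line L /\ act f @` L = L.

Definition hyperboloid (L : set V) (g0 : V) (k : R) : set V :=
  [set p | exists q x : V, [/\ L q, perp g0 x, p = q + x & ldot x x = k ^+ 2]].

Definition admits_crooked_foliation (gamma : R -> affine_map) (g0 p : V) : Prop :=
  exists u : V, [/\ unit_spacelike u, perp g0 u &
    crooked_foliation (fun t => act (gamma t) p) (fun t => lin (gamma t) *m u)].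

End Lorentz.

(* Main.v *)
(* Let n- = -c g^- and n+ = d g^+ with c d (2 g^- . g^+) = 1, so that
   u = n+ - n- is a unit-spacelike director in (g^0)^perp and w = n- + n+ is
   timelike and orthogonal to u. The null pair of u is proportional to
   (w + g^0, w - g^0), hence C(p,u) consists of the points
   p + A u + z w + xi g^0 with xi = -z if A > 0, xi = z if A < 0 and
   |xi| <= |z| if A = 0. The flow translates along g^0 with speed alpha and
   scales n-, n+ by exp(-lt), exp(lt), so that two crooked planes of the family
   meet iff a small system in these coordinates is solvable. With h = l(t-s)/2,
   taking u proportional to the (g^0)^perp component of p makes the system
   insolvable as soon as k tanh h < mu h, which holds for all h > 0 when
   k <= mu. If mu < k, then for h = k/mu - 1 one has mu h <= k tanh h, and
   the stems at times 0 and t = 2h/l meet, whatever u is. *)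

Require Import Defs.
From HB Require Import structures.
From mathcomp Require Import all_boot all_order all_algebra.
From mathcomp Require Import all_classical all_reals all_analysis.
From mathcomp Require Import ring lra.
Import Order.TTheory GRing.Theory Num.Theory numFieldNormedType.Exports.
Local Open Scope classical_set_scope.
Local Open Scope ring_scope.

Set Implicit Arguments.
Unset Strict Implicit.

(** * The matrix exponential *)

Lemma cvg_mx_entries (R : realType) (m n : nat) (u : nat -> 'M[R]_(m, n))
    (M : 'M[R]_(m, n)) :
  (forall i j, (fun k => u k i j) @ \oo --> M i j) -> u @ \oo --> M.
Proof.
move=> H; apply/cvgrPdist_le => e e0; near=> k.
rewrite /Num.Def.normr/= mx_normrE (bigmax_le _ (ltW e0))//= => -[i j] _.
rewrite !mxE/=; move: i j; near: k.
apply: filter_forall => i; apply: filter_forall => j.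
by move/cvgrPdist_le: (H i j) => /(_ _ e0).
Unshelve. all: by end_near. Qed.

Lemma cvg_mx_entry (R : realType) (m n : nat) (u : nat -> 'M[R]_(m, n))
    (M : 'M[R]_(m, n)) i j :
  u @ \oo --> M -> (fun k => u k i j) @ \oo --> M i j.
Proof. by move=> uM; apply: (cvg_comp _ _ uM (@coord_continuous R m n i j M)). Qed.

Lemma cvg_mulmx (R : realType) (m n p : nat) (u : nat -> 'M[R]_(m, n))
    (v : nat -> 'M[R]_(n, p)) (M : 'M[R]_(m, n)) (N : 'M[R]_(n, p)) :
  u @ \oo --> M -> v @ \oo --> N -> (fun k => u k *m v k) @ \oo --> M *m N.
Proof.
move=> uM vN; apply: cvg_mx_entries => i j; rewrite mxE.
under eq_fun do rewrite mxE.
apply: cvg_big => [|l _]; first exact: add_continuous.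
apply: cvgM; exact: cvg_mx_entry.
Qed.

Lemma powmx_entry_bound (R : realType) (n : nat) (X : 'M[R]_n.+1) (c : R) :
  (forall i j, `|X i j| <= c) ->
  forall k i j, `|(X ^+ k) i j| <= (n.+1%:R * c) ^+ k.
Proof.
move=> Xc; have c0 : 0 <= c by apply: le_trans (Xc 0 0).
elim=> [|k IH] i j; first by rewrite expr0 mxE; case: (i == j); rewrite ?normr1 ?normr0.
rewrite exprS mxE; apply: le_trans (ler_norm_sum _ _ _) _.
apply: (@le_trans _ _ (\sum_(l < n.+1) c * (n.+1%:R * c) ^+ k)).
  by apply: ler_sum => l _; rewrite normrM ler_pM.
rewrite sumr_const card_ord [leRHS]exprS.
by rewrite -[in leRHS]mulrA -[leLHS]mulr_natl.
Qed.

(** [expmx] is defined by [limn], which is informative only for a convergent sequence. With [c] the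
    sum of all absolute entries of [X], each entry of the series is dominated by the exponential
    series of [n.+1%:R * c], hence converges absolutely. *)
Lemma expmx_cvg (R : realType) (n : nat) (X : 'M[R]_n.+1) :
  series (fun k : nat => (k`!%:R : R)^-1 *: X ^+ k) @ \oo --> expmx X.
Proof.
pose c := \sum_i \sum_j `|X i j|.
have Xc i j : `|X i j| <= c.
  rewrite /c (bigD1 i)//= (bigD1 j)//= -addrA lerDl addr_ge0//.
    by apply: sumr_ge0.
  by apply: sumr_ge0 => *; apply: sumr_ge0.
suff H i j : cvgn (series (fun k => ((k`!%:R : R)^-1 *: X ^+ k) i j)).
  suff : cvgn (series (fun k : nat => (k`!%:R : R)^-1 *: X ^+ k)) by [].
  apply/cvg_ex; exists (\matrix_(i, j) limn (series (fun k => ((k`!%:R : R)^-1 *: X ^+ k) i j))).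
  apply: cvg_mx_entries => i j; rewrite mxE.
  rewrite (_ : (fun k => _) = series (fun k => ((k`!%:R : R)^-1 *: X ^+ k) i j)); first exact: H.
  by apply/funext => k; rewrite /series/= summxE.
apply: normed_cvg.
apply: series_le_cvg (is_cvg_series_exp_coeff (n.+1%:R * c)).
- by move=> k; exact: normr_ge0.
- move=> k; rewrite /exp_coeff/= divr_ge0// exprn_ge0// mulr_ge0//.
  exact: le_trans (Xc 0 0).
- move=> k; rewrite /exp_coeff/= mxE normrM ger0_norm ?invr_ge0// [leLHS]mulrC.
  by rewrite ler_wpM2r ?invr_ge0//; apply: powmx_entry_bound.
Qed.

Lemma expmx_mul_cvg (R : realType) (n p : nat) (X : 'M[R]_n.+1) (Y : 'M[R]_(n.+1, p)) :
  series (fun k : nat => (k`!%:R : R)^-1 *: (X ^+ k *m Y)) @ \oo --> expmx X *m Y.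
Proof.
rewrite (_ : series _ = (fun k => series (fun k : nat => (k`!%:R : R)^-1 *: X ^+ k) k *m Y)).
  by apply: cvg_mulmx (@expmx_cvg R n X) _; apply: cvg_cst.
apply/funext => k; rewrite /series/= mulmx_suml.
by apply: eq_bigr => i _; rewrite scalemxAl.
Qed.

(** Both products are limits of the series with terms [X ^+ k.+1 / k!]. This later makes the
    generator commute with the linear part at time 1. *)
Lemma expmx_comm (R : realType) (n : nat) (X : 'M[R]_n.+1) :
  X *m expmx X = expmx X *m X.
Proof.
have H := @expmx_mul_cvg R n _ X X.
apply: (cvg_unique _ _ H) => //.
rewrite (_ : series _ = (fun k => X *m series (fun k : nat => (k`!%:R : R)^-1 *: X ^+ k) k)).
  by apply: cvg_mulmx (@expmx_cvg R n X); apply: cvg_cst.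
apply/funext => k; rewrite /series/= mulmx_sumr.
by apply: eq_bigr => i _; rewrite -scalemxAr -[X ^+ i *m X]/(X ^+ i * X) -exprSr exprS.
Qed.

Lemma expmx_eigen (R : realType) (n : nat) (X : 'M[R]_n.+1) (Y : 'cV[R]_n.+1) (c : R) :
  X *m Y = c *: Y -> expmx X *m Y = expR c *: Y.
Proof.
move=> XY; have Xk k : X ^+ k *m Y = c ^+ k *: Y.
  elim: k => [|k IH]; first by rewrite expr0 mul1mx scale1r.
  by rewrite exprS -mulmxA IH -scalemxAr XY scalerA -exprSr.
apply: (cvg_unique _ (@expmx_mul_cvg R n _ X Y)) => //.
rewrite (_ : series _ = (fun k => series (exp_coeff c) k *: Y)).
  apply: cvgZr_tmp; exact: is_cvg_series_exp_coeff.
apply/funext => k; rewrite /series/= scaler_suml.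
by apply: eq_bigr => i _; rewrite Xk scalerA mulrC.
Qed.

(** All powers from the second on kill [Y], so the partial sums are constant from index 2. This
    produces the translation along the axis. *)
Lemma expmx_square_zero (R : realType) (n : nat) (X : 'M[R]_n.+1) (Y : 'cV[R]_n.+1) :
  X *m (X *m Y) = 0 -> expmx X *m Y = Y + X *m Y.
Proof.
move=> XY; have Xk k : X ^+ k.+2 *m Y = 0.
  elim: k => [|k IH]; first by rewrite -mulmxA.
  by rewrite exprS -mulmxA IH mulmx0.
apply: (cvg_unique _ (@expmx_mul_cvg R n _ X Y)) => //.
apply: cvg_near_cst; exists 2 => // k /= k2; rewrite /series/=.
rewrite -(subnKC k2) !big_nat_recl//= big1 ?addr0.
  by rewrite !invr1 !scale1r expr0 expr1 mul1mx.
by move=> i _; rewrite Xk scaler0.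
Qed.

(** * Null pairs and crooked planes *)

Section LorentzAlgebra.
Variable R : realType.
Local Notation V := 'cV[R]_3.
Implicit Types u v w x y n m : V.

Lemma cV3P x y : x 0 0 = y 0 0 -> x 1 0 = y 1 0 -> x 2 0 = y 2 0 -> x = y.
Proof.
move=> e0 e1 e2; apply/colP => i.
case: i => -[|[|[|//]]] Hi.
- by rewrite (_ : Ordinal Hi = 0)//; apply/val_inj.
- by rewrite (_ : Ordinal Hi = 1)//; apply/val_inj.
- by rewrite (_ : Ordinal Hi = 2)//; apply/val_inj.
Qed.

Lemma det3E u v w : det3 u v w =
  u 0 0 * (v 1 0 * w 2 0 - v 2 0 * w 1 0)
  - u 1 0 * (v 0 0 * w 2 0 - v 2 0 * w 0 0)
  + u 2 0 * (v 0 0 * w 1 0 - v 1 0 * w 0 0).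
Proof.
rewrite /det3 (expand_det_col _ 0) !big_ord_recl big_ord0 /cofactor.
rewrite !(expand_det_row _ 0) !big_ord_recl !big_ord0 /cofactor !det_mx11 !mxE/=.
rewrite !(tnth_nth 0)/=.
have -> : lift 0 0 = 1 :> 'I_3 by apply/val_inj.
have -> : lift 0 (lift 0 0) = 2 :> 'I_3 by apply/val_inj.
have -> : lift 1 0 = 0 :> 'I_3 by apply/val_inj.
have -> : lift 1 (lift 0 0) = 2 :> 'I_3 by apply/val_inj.
have -> : lift 2 0 = 0 :> 'I_3 by apply/val_inj.
have -> : lift 2 (lift 0 0) = 1 :> 'I_3 by apply/val_inj.
rewrite /bump/=; ring.
Qed.

Lemma ldotC x y : ldot x y = ldot y x.
Proof. by rewrite /ldot; ring. Qed.
Lemma ldotDl x y z : ldot (x + y) z = ldot x z + ldot y z.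
Proof. by rewrite /ldot !mxE; ring. Qed.
Lemma ldotZl a x z : ldot (a *: x) z = a * ldot x z.
Proof. by rewrite /ldot !mxE; ring. Qed.
Lemma ldotDr x y z : ldot z (x + y) = ldot z x + ldot z y.
Proof. by rewrite /ldot !mxE; ring. Qed.
Lemma ldotZr a x z : ldot z (a *: x) = a * ldot z x.
Proof. by rewrite /ldot !mxE; ring. Qed.
Lemma ldotNl x z : ldot (- x) z = - ldot x z.
Proof. by rewrite /ldot !mxE; ring. Qed.
Lemma ldotNr x z : ldot z (- x) = - ldot z x.
Proof. by rewrite /ldot !mxE; ring. Qed.
Definition ldotE := (ldotDl, ldotDr, ldotZl, ldotZr, ldotNl, ldotNr).

(** Cramer's rule. *)
Lemma det3_basis u v w x : det3 u v w != 0 ->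
  exists a b c, x = a *: u + b *: v + c *: w.
Proof.
move=> d0; exists (det3 x v w / det3 u v w), (det3 u x w / det3 u v w),
  (det3 u v x / det3 u v w).
move: d0; rewrite !det3E => d0.
by apply: cV3P; rewrite !mxE; field.
Qed.

Lemma sum_mul_self_eq0 (a b : R) : a * a + b * b = 0 -> a = 0 /\ b = 0.
Proof.
by move/eqP; rewrite -!expr2 paddr_eq0 ?sqr_ge0// !sqrf_eq0 => /andP[/eqP -> /eqP ->].
Qed.

(** At height 1 null vectors lie on the unit circle, and [ldot n m] is minus half their squared
    distance. *)
Lemma ldot_null_lt0 n m : ldot n n = 0 -> n 2 0 = 1 -> ldot m m = 0 -> m 2 0 = 1 ->
  n != m -> ldot n m < 0.
Proof.
rewrite /ldot => nn n2 mm m2 nm; rewrite lt_neqAle; apply/andP; split; last first.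
  have := sqr_ge0 (n 0 0 - m 0 0); have := sqr_ge0 (n 1 0 - m 1 0).
  by move: nn mm; rewrite n2 m2; nra.
apply: contra nm => /eqP; move: nn mm; rewrite n2 m2 => nn mm nm.
have [e0 e1] : n 0 0 - m 0 0 = 0 /\ n 1 0 - m 1 0 = 0.
  by apply: sum_mul_self_eq0; lra.
by apply/eqP/cV3P; [lra|lra|rewrite n2 m2].
Qed.

(** If [x 2 0 <= 0], Cauchy-Schwarz in the first two coordinates bounds the planar product below by
    [x 2 0], so that [ldot x n >= 0]. *)
Lemma future_of_ldot_lt0 n x : ldot n n = 0 -> n 2 0 = 1 -> ldot x x = 0 ->
  ldot x n < 0 -> 0 < x 2 0.
Proof.
rewrite /ldot => nn n2 xx; rewrite ltNge n2 => xn; apply/negP => x2.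
move: nn xx xn; rewrite n2; set a := n 0 0; set b := n 1 0.
set c := x 0 0; set d := x 1 0; set e := x 2 0 => nn xx xn.
have h : (c * a + d * b) ^+ 2 <= e ^+ 2.
  (* Lagrange's identity, as [a * a + b * b = 1] and [c * c + d * d = e * e]. *)
  have -> : e ^+ 2 = (c * a + d * b) ^+ 2 + (c * b - d * a) ^+ 2.
    transitivity ((c * c + d * d) * (a * a + b * b)); last by ring.
    have -> : c * c + d * d = e * e by lra.
    have -> : a * a + b * b = 1 by lra.
    by ring.
  by rewrite lerDl sqr_ge0.
by move: x2; rewrite -/e => x2; nra.
Qed.

Lemma null_normalized x n : ldot n n = 0 -> n 2 0 = 1 -> ldot x x = 0 -> ldot x n < 0 ->
  let y := (x 2 0)^-1 *: x in null y /\ y 2 0 = 1.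
Proof.
move=> nn n2 xx xn y; have x2 := future_of_ldot_lt0 nn n2 xx xn.
have y2 : y 2 0 = 1 by rewrite mxE mulVf// gt_eqF.
split => //; split.
  by apply/eqP => y0; move: y2; rewrite y0 mxE => /esym/eqP; rewrite oner_eq0.
by rewrite /y !ldotE xx !mulr0.
Qed.

(** [null_pair] is a choice, so existence and uniqueness are both at stake. In the plane spanned by
    [n] and [m] the form is [2 a b (ldot n m)], so the only null lines are those of [n] and [m]. *)
Lemma null_pairP u n m : spacelike u -> null n -> n 2 0 = 1 -> null m -> m 2 0 = 1 ->
  ldot n u = 0 -> ldot m u = 0 -> 0 < det3 u n m -> null_pair u = (n, m).
Proof.
move=> [_ uu] nN n2 mN m2 nu mu d.
have nm : n != m by apply: contraL d => /eqP ->; rewrite det3E -leNgt; lra.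
have [[_ nn] [_ mm]] := (nN, mN).
have c0 := ldot_null_lt0 nn n2 mm m2 nm.
have P : is_null_pair u (n, m).
  split => //; apply/seteqP; split => x /=.
    rewrite /perp/= => xu; have [a [b [c xE]]] := det3_basis x (lt0r_neq0 d).
    exists b, c; have : a * ldot u u = 0.
      by rewrite -xu xE !ldotE nu mu; ring.
    by move/eqP; rewrite mulf_eq0 (gt_eqF uu) orbF xE => /eqP ->; rewrite scale0r add0r.
  by move=> [a [b ->]]; rewrite /perp/= !ldotE nu mu; ring.
have cls y : null y -> y 2 0 = 1 -> perp u y -> y = n \/ y = m.
  move=> [_ yy] y2; rewrite (_ : perp u = span2 n m); last by case: P.
  move=> [a [b yE]].
  have : a * b * ldot n m = 0.
    by move: yy; rewrite yE !ldotE nn mm (ldotC m n); lra.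
  move/eqP; rewrite mulf_eq0 (lt_eqF c0) orbF mulf_eq0 => /orP[]/eqP z0; [right|left];
    move: y2; rewrite yE z0 scale0r ?add0r ?addr0 mxE ?n2 ?m2 mulr1 => ->;
    by rewrite scale1r.
rewrite /null_pair; case: xgetP => [[n' m'] _|/(_ (n, m))//].
move=> [[/= n'N n'2] [m'N m'2] E d'].
have [pn pm] : perp u n' /\ perp u m'.
  rewrite E; split; [exists 1, 0|exists 0, 1]; by rewrite scale1r scale0r ?addr0 ?add0r.
(* Besides [(n, m)], the candidates [(n, n)] and [(m, m)] have determinant zero and [(m, n)] a
   negative one. *)
case: (cls _ n'N n'2 pn) => ?; case: (cls _ m'N m'2 pm) => ?; subst n' m' => //;
  by exfalso; move: d d'; rewrite !det3E; lra.
Qed.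

(* In a spacelike plane containing the null direction m and u, the null pair of
   A u + B m consists of m and a second null vector; the sign of A decides
   which of the two comes last. *)
Lemma null_pair_of_combination u n m (A B : R) :
  unit_spacelike u -> null n -> n 2 0 = 1 -> null m -> m 2 0 = 1 ->
  ldot n u = 0 -> ldot m u = 0 -> det3 u n m != 0 -> A != 0 ->
  exists q, [/\ q != m, null q, q 2 0 = 1,
    0 < A * det3 u n m -> null_pair (A *: u + B *: m) = (q, m) &
    A * det3 u n m < 0 -> null_pair (A *: u + B *: m) = (m, q)].
Proof.
rewrite /unit_spacelike => uu nN n2 mN m2 nu mu d A0.
have nm : n != m by apply: contraNneq d => ->; rewrite det3E; apply/eqP; ring.
have [[_ nn] [_ mm]] := (nN, mN).
have c0 := ldot_null_lt0 nn n2 mm m2 nm.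
(* Among vectors with [n]-coefficient 1, orthogonality to [A *: u + B *: m] fixes the coefficient
   [beta] of [u], and nullity then fixes that of [m]. *)
pose beta := - B * ldot n m / A.
pose y := n + beta *: u - (beta ^+ 2 / (2 * ldot n m)) *: m.
have yy : ldot y y = 0.
  rewrite /y !ldotE nn mm (ldotC u n) (ldotC u m) (ldotC m n) nu mu uu; field.
  by rewrite (lt_eqF c0).
have ym : ldot y m < 0 by rewrite /y !ldotE mm (ldotC u m) mu; lra.
have y2 := future_of_ldot_lt0 mm m2 yy ym.
have [qN q2] := null_normalized mm m2 yy ym.
set q := _ *: y in qN q2.
have Ex : A *: u + B *: m != 0.
  apply/eqP => x0; have : A * ldot u u = 0.
    have -> : A * ldot u u = ldot (A *: u + B *: m) u by rewrite !ldotE mu; ring.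
    by rewrite x0 /ldot !mxE; ring.
  by rewrite uu mulr1 => /eqP; rewrite (negbTE A0).
have xs : spacelike (A *: u + B *: m).
  split => //; rewrite !ldotE (ldotC u m) mu mm uu.
  have : 0 < A ^+ 2 by rewrite exprn_even_gt0.
  by rewrite expr2; lra.
have qx : ldot q (A *: u + B *: m) = 0.
  suff yx : ldot y (A *: u + B *: m) = 0 by rewrite /q ldotZl yx mulr0.
  by rewrite /y !ldotE nu mu mm uu (ldotC u m) mu /beta; field; rewrite A0 (lt_eqF c0).
have mx : ldot m (A *: u + B *: m) = 0 by rewrite !ldotE mu mm; ring.
have dq : det3 (A *: u + B *: m) q m = (y 2 0)^-1 * (A * det3 u n m).
  by rewrite !det3E /q /y !mxE; ring.
exists q; split => //.
- apply/eqP => qm; have : ldot q m < 0 by rewrite /q ldotZl pmulr_rlt0 ?invr_gt0.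
  by rewrite qm mm ltxx.
- by move=> dA; apply: null_pairP => //; rewrite dq mulr_gt0 ?invr_gt0.
- move=> dA; apply: null_pairP => //.
  have -> : det3 (A *: u + B *: m) m q = - det3 (A *: u + B *: m) q m.
    by rewrite !det3E; ring.
  by rewrite dq oppr_gt0 pmulr_rlt0 ?invr_gt0.
Qed.

(** A certificate that [(n, m)] is the null pair of a unit director [u], free of the choice
    operator. *)
Definition null_frame u n m : Prop :=
  [/\ unit_spacelike u, null n /\ n 2 0 = 1, null m /\ m 2 0 = 1,
      ldot n u = 0 /\ ldot m u = 0 & 0 < det3 u n m].

Lemma null_pair_frame u n m : null_frame u n m -> null_pair u = (n, m).
Proof.
move=> [uu [nN n2] [mN m2] [nu mu] d]; apply: null_pairP => //; split; last by rewrite uu.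
by apply/eqP => u0; move: uu; rewrite u0 /unit_spacelike /ldot !mxE; lra.
Qed.

Lemma null_frameN u n m : null_frame u n m -> null_frame (- u) m n.
Proof.
move=> [uu nN mN [nu mu] d]; split => //.
- by rewrite /unit_spacelike !ldotE opprK.
- by rewrite !ldotNr nu mu oppr0.
- by move: d; rewrite !det3E !mxE; lra.
Qed.

(** Orthogonality to [m] kills the [n]-coordinate. If [A < 0], the null pair of [x] has [m] first
    and a different vector last, contradicting [uplus x = m]. *)
Lemma wing_plus_frame u n m x : null_frame u n m ->
  wing_plus u x <-> exists A B, 0 < A /\ x = A *: u + B *: m.
Proof.
move=> F; have [uu [nN n2] [mN m2] [nu mu] d] := F.
have nm : n != m by apply: contraL d => /eqP ->; rewrite det3E -leNgt; lra.
have [[_ nn] [_ mm]] := (nN, mN).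
have c0 := ldot_null_lt0 nn n2 mm m2 nm.
have um : uplus u = m by rewrite /uplus (null_pair_frame F).
rewrite /wing_plus /= um; split.
  move=> [xm [_ xx] xp].
  have [A [C [B xE]]] := det3_basis x (lt0r_neq0 d).
  have : C * ldot n m = 0.
    by rewrite -xm xE !ldotE mm (ldotC u m) mu; ring.
  move/eqP; rewrite mulf_eq0 (lt_eqF c0) orbF => /eqP C0.
  rewrite C0 scale0r addr0 in xE.
  have A0 : A != 0.
    apply/eqP => A0; move: xx; rewrite xE A0 scale0r add0r !ldotE mm; lra.
  exists A, B; split => //; rewrite ltNge le_eqVlt (negbTE A0)/=; apply/negP => An.
  have [q [qm _ _ _ H]] :=
    null_pair_of_combination B uu nN n2 mN m2 nu mu (lt0r_neq0 d) A0.
  have dA : A * det3 u n m < 0 by rewrite nmulr_rlt0.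
  by move: xp; rewrite /uplus xE (H dA)/= => qE; rewrite qE eqxx in qm.
move=> [A [B [A0 ->]]].
have [q [qm _ _ H _]] :=
  null_pair_of_combination B uu nN n2 mN m2 nu mu (lt0r_neq0 d) (lt0r_neq0 A0).
have dA : 0 < A * det3 u n m by rewrite mulr_gt0.
have xx : ldot (A *: u + B *: m) (A *: u + B *: m) = A * A.
  by rewrite !ldotE mm (ldotC u m) mu uu; ring.
split; first by rewrite /perp/= !ldotE mm (ldotC u m) mu; ring.
  split; last by rewrite xx mulr_gt0.
  apply/eqP => x0; move: xx; rewrite x0 /ldot !mxE; nra.
by rewrite /uplus H.
Qed.

(** Negating the director swaps its null pair; hence only one kind of wing has to be described. *)
Lemma wing_minusN u n m : null_frame u n m -> wing_minus u = wing_plus (- u).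
Proof.
move=> F; rewrite /wing_minus /wing_plus /uminus (null_pair_frame F).
by rewrite {2 4}/uplus (null_pair_frame (null_frameN F)).
Qed.

Lemma stemN u : stem (- u) = stem u.
Proof.
apply/seteqP; rewrite /stem /perp; split => x /= [xu xx]; split => //.
  by apply/eqP; rewrite -oppr_eq0 -ldotNr; apply/eqP.
by rewrite ldotNr xu oppr0.
Qed.

Lemma crooked_planeN p u n m : null_frame u n m -> crooked_plane p (- u) = crooked_plane p u.
Proof.
move=> F; rewrite /crooked_plane (wing_minusN (null_frameN F)) (wing_minusN F) stemN.
by rewrite opprK -!setUA [in RHS](setUC (wing_plus u)).
Qed.

(** On the plane of the stem the form is [2 B C (ldot n m)] with [ldot n m < 0]. *)
Lemma stem_frame u n m x : null_frame u n m ->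
  stem u x <-> exists B C, 0 <= B * C /\ x = B *: n + C *: m.
Proof.
move=> [uu [nN n2] [mN m2] [nu mu] d].
have nm : n != m by apply: contraL d => /eqP ->; rewrite det3E -leNgt; lra.
have [[_ nn] [_ mm]] := (nN, mN).
have c0 := ldot_null_lt0 nn n2 mm m2 nm.
rewrite /stem /perp/=; split.
  move=> [xu xx]; have [A [B [C xE]]] := det3_basis x (lt0r_neq0 d).
  have A0 : A = 0 by rewrite -xu xE !ldotE nu mu uu; ring.
  rewrite A0 scale0r add0r in xE.
  exists B, C; split => //; move: xx; rewrite xE !ldotE nn mm (ldotC m n); nra.
move=> [B [C [BC ->]]]; split; first by rewrite !ldotE nu mu; ring.
by rewrite !ldotE nn mm (ldotC m n); nra.
Qed.

End LorentzAlgebra.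

(* Coordinates of a point of a crooked plane relative to its vertex: along the
   director, along the timelike axis of the stem, and along g0. *)
Definition crooked_coord (R : realType) (A z xi : R) : Prop :=
  [\/ 0 < A /\ xi = - z, A < 0 /\ xi = z | A = 0 /\ xi ^+ 2 <= z ^+ 2].

(** * Crooked planes in coordinates adapted to the hyperbolic flow *)

Section Frame.
Variable R : realType.
Local Notation V := 'cV[R]_3.
Variables gm gp g0 : V.

Definition lorentz_frame : Prop :=
  [/\ ldot gm gm = 0 /\ gm 2 0 = 1, ldot gp gp = 0 /\ gp 2 0 = 1,
      ldot g0 g0 = 1, ldot g0 gm = 0 /\ ldot g0 gp = 0 &
      0 < det3 g0 gm gp].

Hypothesis F : lorentz_frame.

Lemma ldot_frame_lt0 : ldot gm gp < 0.
Proof.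
have [[mm m2] [pp p2] _ _ d] := F; apply: ldot_null_lt0 => //.
by apply: contraL d => /eqP ->; rewrite det3E -leNgt; lra.
Qed.

(** The normalization gives [ldot w w = -1], so [w + g0] and [w - g0] are null, and both are
    orthogonal to the director. [0 < d] makes them future pointing; [a] and [b] are the inverses of
    their third coordinates. *)
Lemma frame_null_frame (c d : R) (w := (- c) *: gm + d *: gp) :
  2 * (c * d * ldot gm gp) = 1 -> 0 < d ->
  exists a b, [/\ 0 < a, 0 < b &
    null_frame (c *: gm + d *: gp) (a *: (w + g0)) (b *: (w - g0))].
Proof.
move=> cd d0; have [[mm m2] [pp p2] g00 [g0m g0p] D] := F.
have m0 := ldot_frame_lt0.
have c0 : c < 0.
  rewrite ltNge; apply/negP => c0.
  have : c * d * ldot gm gp <= 0 by rewrite nmulr_lle0 ?mulr_ge0// ltW.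
  lra.
have w1 : ldot (w + g0) (w + g0) = 0.
  rewrite /w !ldotE mm pp g00 g0m g0p (ldotC gm g0) (ldotC gp g0) g0m g0p (ldotC gp gm).
  lra.
have w2 : ldot (w - g0) (w - g0) = 0.
  rewrite /w !ldotE mm pp g00 g0m g0p (ldotC gm g0) (ldotC gp g0) g0m g0p (ldotC gp gm).
  lra.
have w1m : ldot (w + g0) gm < 0.
  by rewrite /w !ldotE mm g0m (ldotC gp gm); nra.
have w2m : ldot (w - g0) gm < 0.
  by rewrite /w !ldotE mm g0m (ldotC gp gm); nra.
have a0 := future_of_ldot_lt0 mm m2 w1 w1m.
have b0 := future_of_ldot_lt0 mm m2 w2 w2m.
exists ((w + g0) 2 0)^-1, ((w - g0) 2 0)^-1; rewrite !invr_gt0; split => //.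
split.
- by rewrite /unit_spacelike !ldotE mm pp (ldotC gp gm); lra.
- exact: null_normalized mm m2 w1 w1m.
- exact: null_normalized mm m2 w2 w2m.
- by rewrite !ldotZl; split; rewrite /w !ldotE mm pp g0m g0p (ldotC gp gm); ring.
- have -> (a b : R) : det3 (c *: gm + d *: gp) (a *: (w + g0)) (b *: (w - g0)) =
      a * b * (- (4 * c * d)) * det3 g0 gm gp.
    by rewrite !det3E /w !mxE; ring.
  by rewrite !mulr_gt0 ?invr_gt0//; nra.
Qed.

Lemma crooked_plane_frame (c d : R) (p y : V) : 2 * (c * d * ldot gm gp) = 1 ->
  crooked_plane p (c *: gm + d *: gp) y <->
  exists A z xi, y = p + (A *: (c *: gm + d *: gp) + z *: ((- c) *: gm + d *: gp) + xi *: g0)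
    /\ crooked_coord A z xi.
Proof.
(* Negating [(c, d)] negates the director and the timelike axis: [A] and [z] change sign, and the
   two wing cases of [crooked_coord] are exchanged. *)
wlog d0 : c d / 0 < d => [H cd|].
  have [d0|] := ltP 0 d; first exact: H.
  rewrite le_eqVlt => /orP[/eqP d0|d0]; first by exfalso; move: cd; rewrite d0; lra.
  have nd0 : 0 < - d by rewrite oppr_gt0.
  have ncd : 2 * (- c * - d * ldot gm gp) = 1 by rewrite mulrNN.
  have [a [b [_ _ N]]] := frame_null_frame ncd nd0.
  have E : c *: gm + d *: gp = - ((- c) *: gm + (- d) *: gp).
    by rewrite !scaleNr -opprD opprK.
  rewrite E (crooked_planeN p N) -E (H _ _ nd0 ncd).
  by split=> -[A [z [xi [-> K]]]]; exists (- A), (- z), xi; split;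
    [by congr (_ + _); apply: cV3P; rewrite !mxE; ring
    |case: K => -[h1 h2]; [apply: Or32|apply: Or31|apply: Or33]; split;
      rewrite ?oppr_lt0 ?oppr_gt0 ?opprK ?sqrrN ?h1 ?oppr0
    |by congr (_ + _); apply: cV3P; rewrite !mxE; ring
    |case: K => -[h1 h2]; [apply: Or32|apply: Or31|apply: Or33]; split;
      rewrite ?oppr_lt0 ?oppr_gt0 ?opprK ?sqrrN ?h1 ?oppr0].
move=> cd; have [a [b [a0 b0 N]]] := frame_null_frame cd d0.
set u := c *: gm + d *: gp in N *; set w := (- c) *: gm + d *: gp in N *.
have NN := null_frameN N.
rewrite /crooked_plane (wing_minusN N)/=; split.
  move=> [x [[xs|xs]|xs] <-].
  - have [B [C [BC ->]]] := (stem_frame x N).1 xs.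
    exists 0, (B * a + C * b), (B * a - C * b); split.
      by congr (_ + _); apply: cV3P; rewrite !mxE; ring.
    apply: Or33; split => //; rewrite -subr_ge0.
    have -> : (B * a + C * b) ^+ 2 - (B * a - C * b) ^+ 2 = 4 * (B * C) * (a * b) by ring.
    by apply: mulr_ge0; [apply: mulr_ge0|apply: ltW; apply: mulr_gt0].
  - have [A [B [A0 ->]]] := (wing_plus_frame x N).1 xs.
    exists A, (B * b), (- (B * b)); split; last exact: Or31.
    by congr (_ + _); apply: cV3P; rewrite !mxE; ring.
  - have [A [B [A0 ->]]] := (wing_plus_frame x NN).1 xs.
    exists (- A), (B * a), (B * a); split; last by apply: Or32; rewrite oppr_lt0.
    by congr (_ + _); apply: cV3P; rewrite !mxE; ring.
move=> [A [z [xi [-> K]]]].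
exists (A *: u + z *: w + xi *: g0) => //; case: K => -[h1 h2].
- left; right; apply/(wing_plus_frame _ N); exists A, (z / b); split => //.
  by rewrite h2 scalerA divfK ?gt_eqF//; apply: cV3P; rewrite !mxE; ring.
- right; apply/(wing_plus_frame _ NN); exists (- A), (z / a); rewrite oppr_gt0; split => //.
  by rewrite h2 scalerA divfK ?gt_eqF//; apply: cV3P; rewrite !mxE; ring.
- left; left; apply/(stem_frame _ N).
  (* The solution of [B * a + C * b = z] and [B * a - C * b = xi]. *)
  exists ((z + xi) / 2 / a), ((z - xi) / 2 / b); split.
    have -> : (z + xi) / 2 / a * ((z - xi) / 2 / b) =
      (z ^+ 2 - xi ^+ 2) / (4 * (a * b)) by field; rewrite !gt_eqF.
    by rewrite divr_ge0 ?subr_ge0// !mulr_ge0 ?ltW.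
  by rewrite h1 !scalerA !divfK ?gt_eqF//; apply: cV3P; rewrite !mxE; field.
Qed.

Lemma frame_coord_inj (a b c a' b' c' : R) :
  a *: gm + b *: gp + c *: g0 = a' *: gm + b' *: gp + c' *: g0 ->
  [/\ a = a', b = b' & c = c'].
Proof.
have [[mm m2] [pp p2] g00 [g0m g0p] _] := F.
have m0 := ldot_frame_lt0 => E.
have Ep := congr1 (fun v => ldot v gp) E; have Em := congr1 (fun v => ldot v gm) E.
have E0 := congr1 (fun v => ldot v g0) E.
move: Ep Em E0; rewrite !ldotE mm pp g00 g0m g0p (ldotC gm g0) (ldotC gp g0) g0m g0p.
rewrite (ldotC gp gm) => Ep Em E0; split; last by lra.
  by apply: (mulIf (ltr0_neq0 m0)); lra.
by apply: (mulIf (ltr0_neq0 m0)); lra.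
Qed.

Lemma frame_coord x : exists a b c, x = a *: gm + b *: gp + c *: g0.
Proof.
have [_ _ _ _ /lt0r_neq0 /(det3_basis x) [c [a [b ->]]]] := F.
by exists a, b, c; rewrite [RHS]addrC addrA.
Qed.

End Frame.

(** * Smoothness of orbits and director curves *)

Section Curve.
Variables (R : realType) (m n : nat) (l : R).
Local Notation V := 'M[R]_(m.+1, n.+1).
Implicit Types P Q Y Z : V.

(** This family contains the orbits and the director curves and is closed under differentiation, so
    smoothness is an induction on the order. *)
Definition exp_curve P Q Y Z (t : R) : V :=
  P + t *: Q + expR (t * - l) *: Y + expR (t * l) *: Z.

Lemma is_derive_exp_curve_entry (p q y z t : R) :
  is_derive t 1 (fun t => p + t * q + expR (t * - l) * y + expR (t * l) * z)
    (q + expR (t * - l) * (- l * y) + expR (t * l) * (l * z)).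
Proof.
have He (c : R) : is_derive t 1 (fun t => expR (t * c)) (expR (t * c) * c).
  have Hc : is_derive t 1 (fun t : R => t * c) c.
    by apply: is_derive_eq; rewrite scaler0 add0r /GRing.scale/= mulr1.
  have H := @is_derive1_comp R expR (fun t => t * c) t _ _ (is_derive_expR _) Hc.
  exact: H.
have H1 := He (- l); have H2 := He l.
apply: is_derive_eq; rewrite /GRing.scale/=; ring.
Qed.

Lemma derivable_exp_curve P Q Y Z t : derivable (exp_curve P Q Y Z) t 1.
Proof.
apply/derivable_mxP => i j; rewrite /exp_curve.
under eq_fun do rewrite !mxE.
by have [] := is_derive_exp_curve_entry (P i j) (Q i j) (Y i j) (Z i j) t.
Qed.

Lemma derive1_exp_curve P Q Y Z :
  derive1 (exp_curve P Q Y Z) = exp_curve Q 0 (- l *: Y) (l *: Z).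
Proof.
apply/funext => t; rewrite derive1E derive_mx; last exact: derivable_exp_curve.
apply/matrixP => i j; rewrite !mxE.
under [in LHS]eq_fun do rewrite !mxE.
have [_ ->] := is_derive_exp_curve_entry (P i j) (Q i j) (Y i j) (Z i j) t.
by rewrite mulr0 addr0.
Qed.

Lemma derivable_derive1n_exp_curve k P Q Y Z t :
  derivable (derive1n k (exp_curve P Q Y Z)) t 1.
Proof.
elim: k P Q Y Z => [|k IH] P Q Y Z; first by rewrite derive1n0; exact: derivable_exp_curve.
by rewrite derive1Sn derive1_exp_curve; exact: IH.
Qed.

Lemma continuous_exp_curve P Q Y Z : continuous (exp_curve P Q Y Z).
Proof.
move=> t; apply: differentiable_continuous.
apply/derivable1_diffP; exact: derivable_exp_curve.
Qed.

End Curve.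

(** * Hyperbolic tangent estimates and the separation inequality *)

Section RealEstimates.
Variable R : realType.

(* With x = 2h this is tanh h < h. *)
Lemma tanh_lt (x : R) : 0 < x -> 2 * (expR x - 1) < x * (expR x + 1).
Proof.
move=> x0; pose f (y : R) := y * (expR y + 1) - 2 * (expR y - 1).
have df (y : R) : is_derive y 1 f ((y - 1) * expR y + 1).
  by rewrite /f; apply: is_derive_eq; rewrite /GRing.scale/=; ring.
have cf : {within `[0, x], continuous f}.
  by apply: derivable_within_continuous => y _; have [] := df y.
have [c] := MVT x0 (fun y _ => df y) cf.
rewrite in_itv/= => /andP[c0 _] E.
suff : 0 < f x by rewrite /f subr_gt0.
have f0 : f 0 = 0 by rewrite /f expR0; ring.
move: E; rewrite f0 !subr0 => ->; rewrite mulr_gt0//.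
(* Positivity of the derivative [(c - 1) * expR c + 1] is this inequality multiplied by [expR c]. *)
have : 1 + - c < expR (- c) by apply: expR_gt1Dx; rewrite oppr_eq0 gt_eqF.
rewrite -(ltr_pM2r (expR_gt0 c)) -expRD addNr expR0; lra.
Qed.

(** The difference of the two sides is [2 * (expR x - 1 - x)]. With [x = 2h] this is
    [h <= (1 + h) tanh h]. *)
Lemma tanh_ge (x : R) : 0 <= x -> x * (expR x + 1) <= (2 + x) * (expR x - 1).
Proof. by move=> x0; have := expR_ge1Dx x; lra. Qed.

(** Here [q] stands for [exp (2h)], [T] for [tanh h] and [D] for the translation along [g0]. Adding
    and subtracting the first two equations yields [A1 - A2 = T * (z1 + z2)] and
    [z1 - z2 = T * (2 * k + A1 + A2)]. In each of the nine combinations of stems and wings these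
    force [xi1 - xi2 <= 2 * k * T], which is less than [D]. *)
Lemma crooked_coord_separated (k D q A1 z1 xi1 A2 z2 xi2 : R) :
  0 < k -> 1 < q -> 2 * k * (q - 1) < D * (q + 1) ->
  crooked_coord A1 z1 xi1 -> crooked_coord A2 z2 xi2 ->
  (k + A1 - z1) * q = k + A2 - z2 -> k + A1 + z1 = (k + A2 + z2) * q ->
  xi1 - xi2 = D -> False.
Proof.
move=> k0 q1 Dq K1 K2 Em Ep ED.
have q1' : 0 < q + 1 by lra.
pose T := (q - 1) / (q + 1).
have T0 : 0 < T by rewrite divr_gt0// subr_gt0.
have DT : 2 * k * T < D by rewrite /T mulrA ltr_pdivrMr.
have Es : z1 - z2 = T * (2 * k + A1 + A2).
  by apply: (mulIf (lt0r_neq0 q1')); rewrite /T mulrAC divfK ?gt_eqF//; lra.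
have Ed : A1 - A2 = T * (z1 + z2).
  by apply: (mulIf (lt0r_neq0 q1')); rewrite /T mulrAC divfK ?gt_eqF//; lra.
have kT0 := mulr_gt0 k0 T0.
have D0 : 0 < D by lra.
clearbody T; clear Em Ep Dq q1' q1 q.
have sq_bound (a b : R) : a ^+ 2 <= b ^+ 2 -> -`|b| <= a <= `|b|.
  move=> ab; rewrite -ler_norml -(@ler_pXn2r _ 2%N) ?nnegrE//.
  by rewrite !real_normK ?num_real.
have Es1 : z1 - z2 = 2 * (k * T) + T * A1 + T * A2 by rewrite Es; ring.
(* The signs of the products with [T] are recorded beforehand, so that the cases below are
   linear. *)
have Pp : 0 < A1 - A2 -> 0 < z1 + z2 by rewrite Ed pmulr_rgt0.
have Pn : A1 - A2 < 0 -> z1 + z2 < 0 by rewrite Ed pmulr_rlt0.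
have T1 : 0 < A1 -> 0 < T * A1 by exact: mulr_gt0.
have T1n : A1 < 0 -> T * A1 < 0 by rewrite pmulr_rlt0.
have T2 : 0 < A2 -> 0 < T * A2 by exact: mulr_gt0.
have T2n : A2 < 0 -> T * A2 < 0 by rewrite pmulr_rlt0.
have N (a : R) : `|a| = a \/ `|a| = - a by have [a0|a0] := leP 0 a; [left; rewrite ger0_norm|right; rewrite ltr0_norm].
case: K1 => -[h1 h1']; case: K2 => -[h2 h2'].
- by have := T1 h1; have := T2 h2; lra.
- by have := Pp ltac:(lra); lra.
- have := Pp ltac:(lra); have := T1 h1; have /andP[] := sq_bound _ _ h2'.
  by rewrite h2 mulr0 in Es1; case: (N z2) => ->; lra.
- by have := Pn ltac:(lra); lra.
- by have := T1n h1; have := T2n h2; lra.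
- have := Pn ltac:(lra); have := T1n h1; have /andP[] := sq_bound _ _ h2'.
  by rewrite h2 mulr0 in Es1; case: (N z2) => ->; lra.
- have := Pn ltac:(lra); have := T2 h2; have /andP[] := sq_bound _ _ h1'.
  by rewrite h1 mulr0 in Es1; case: (N z1) => ->; lra.
- have := Pp ltac:(lra); have := T2n h2; have /andP[] := sq_bound _ _ h1'.
  by rewrite h1 mulr0 in Es1; case: (N z1) => ->; lra.
(* Two stems: [z1 = k * T] and [z2 = - (k * T)], so [xi1 - xi2] can reach exactly [2 * k * T]. *)
- have : z1 + z2 = 0.
    have /eqP : T * (z1 + z2) = 0 by rewrite -Ed h1 h2 subr0.
    by rewrite mulf_eq0 (gt_eqF T0) => /eqP.
  have /andP[] := sq_bound _ _ h1'; have /andP[] := sq_bound _ _ h2'.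
  rewrite h1 h2 !mulr0 in Es1; case: (N z1) => ->; case: (N z2) => ->; lra.
Qed.

End RealEstimates.

(** * Orbits of the normal form of a hyperbolic flow *)

Section Orbit.
Variable R : realType.
Local Notation V := 'cV[R]_3.
Variables (gm gp g0 : V) (l alpha : R).
Hypotheses (F : lorentz_frame gm gp g0) (l0 : 0 < l) (alpha0 : 0 < alpha).

Definition frame_orbit (o : V) (a b : R) : R -> V :=
  exp_curve l o (alpha *: g0) (a *: gm) (b *: gp).
Definition frame_director (c d : R) : R -> V :=
  exp_curve l 0 0 (c *: gm) (d *: gp).

Lemma frame_directorE c d t : frame_director c d t =
  (c * expR (t * - l)) *: gm + (d * expR (t * l)) *: gp.
Proof. by apply: cV3P; rewrite !mxE; ring. Qed.

Lemma director_normalized c d t : 2 * (c * d * ldot gm gp) = 1 ->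
  2 * (c * expR (t * - l) * (d * expR (t * l)) * ldot gm gp) = 1.
Proof.
move=> cd; rewrite -[RHS]cd mulrACA -expRD mulrN addNr expR0; ring.
Qed.

Lemma crooked_plane_orbit c d o a b t y : 2 * (c * d * ldot gm gp) = 1 ->
  crooked_plane (frame_orbit o (a * c) (b * d) t) (frame_director c d t) y <->
  exists A z xi, y = o + (((a + A - z) * (c * expR (t * - l))) *: gm +
      ((b + A + z) * (d * expR (t * l))) *: gp + (alpha * t + xi) *: g0)
    /\ crooked_coord A z xi.
Proof.
move=> cd; rewrite frame_directorE (crooked_plane_frame F _ _ (director_normalized t cd)).
by split=> -[A [z [xi [-> K]]]]; exists A, z, xi; split=> //; apply: cV3P; rewrite !mxE; ring.
Qed.

Lemma crooked_planes_meet c d o a b s t : 2 * (c * d * ldot gm gp) = 1 ->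
  crooked_plane (frame_orbit o (a * c) (b * d) s) (frame_director c d s) `&`
  crooked_plane (frame_orbit o (a * c) (b * d) t) (frame_director c d t) !=set0 <->
  exists A1 z1 xi1 A2 z2 xi2,
    [/\ crooked_coord A1 z1 xi1, crooked_coord A2 z2 xi2,
      (a + A1 - z1) * expR (l * (t - s)) = a + A2 - z2,
      b + A1 + z1 = (b + A2 + z2) * expR (l * (t - s)) &
      xi1 - xi2 = alpha * (t - s)].
Proof.
move=> cd; set q := expR (l * (t - s)).
have Em : expR (s * - l) = q * expR (t * - l) by rewrite /q -expRD; congr expR; ring.
have Ep : expR (t * l) = q * expR (s * l) by rewrite /q -expRD; congr expR; ring.
have c0 : c * expR (t * - l) != 0.
  rewrite mulf_neq0 ?(gt_eqF (expR_gt0 _))//; apply/eqP => c0; move: cd; rewrite c0; lra.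
have d0 : d * expR (s * l) != 0.
  rewrite mulf_neq0 ?(gt_eqF (expR_gt0 _))//; apply/eqP => d0; move: cd; rewrite d0; lra.
split.
  move=> [y [/(crooked_plane_orbit _ _ _ _ _ cd) [A1 [z1 [xi1 [y1 K1]]]]
             /(crooked_plane_orbit _ _ _ _ _ cd) [A2 [z2 [xi2 [y2 K2]]]]]].
  exists A1, z1, xi1, A2, z2, xi2.
  have := y1; rewrite y2 => /addrI/(frame_coord_inj F) [e1 e2 e3].
  split => //; last by lra.
    by apply: (mulIf c0); rewrite e1 Em; ring.
  by apply: (mulIf d0); rewrite -e2 Ep; ring.
move=> [A1 [z1 [xi1 [A2 [z2 [xi2 [K1 K2 e1 e2 e3]]]]]]].
have h1 : (a + A1 - z1) * (c * expR (s * - l)) = (a + A2 - z2) * (c * expR (t * - l)).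
  by rewrite -e1 Em; ring.
have h2 : (b + A1 + z1) * (d * expR (s * l)) = (b + A2 + z2) * (d * expR (t * l)).
  by rewrite e2 Ep; ring.
have h3 : alpha * s + xi1 = alpha * t + xi2 by lra.
eexists; split; apply/(crooked_plane_orbit _ _ _ _ _ cd).
  by exists A1, z1, xi1; split.
by exists A2, z2, xi2; split=> //; rewrite h1 h2 h3.
Qed.

(** The velocity has the constant component [alpha] along [g0]. *)
Lemma regular_frame_orbit o a b : regular_curve (frame_orbit o a b).
Proof.
split=> [n t|t]; first exact: derivable_derive1n_exp_curve.
rewrite derive1_exp_curve; apply/eqP => E.
have : (- l * a * expR (t * - l)) *: gm + (l * b * expR (t * l)) *: gp + alpha *: g0
     = 0 *: gm + 0 *: gp + 0 *: g0.
  rewrite !scale0r !addr0 -E; apply: cV3P; rewrite !mxE; ring.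
by move=> /(frame_coord_inj F) [_ _ a0]; move: alpha0; rewrite a0 ltxx.
Qed.

(** Here [a = b = k], so meeting planes would solve the system excluded by
    [crooked_coord_separated]. *)
Lemma foliation_of_le k c d o : 0 < k -> k <= alpha / l ->
  2 * (c * d * ldot gm gp) = 1 ->
  crooked_foliation (frame_orbit o (k * c) (k * d)) (frame_director c d).
Proof.
move=> k0 kmu cd; split.
- exact: regular_frame_orbit.
- exact: continuous_exp_curve.
- move=> t; have [[mm _] [pp _] _ _ _] := F; have := director_normalized t cd.
  rewrite frame_directorE; set x := c * _; set y := d * _ => xy.
  have uu : ldot (x *: gm + y *: gp) (x *: gm + y *: gp) = 1.
    by rewrite !ldotE mm pp (ldotC gp gm); lra.
  split; last by rewrite uu.
  by apply/eqP => u0; move: uu; rewrite u0 /ldot !mxE; lra.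
suff H (s t : R) : s < t ->
    crooked_plane (frame_orbit o (k * c) (k * d) s) (frame_director c d s) `&`
    crooked_plane (frame_orbit o (k * c) (k * d) t) (frame_director c d t) = set0.
  move=> s t; rewrite neq_lt => /orP[|/H]; first exact: H.
  by rewrite setIC.
move=> st; apply/eqP; apply: contrapT => /negP/set0P/(crooked_planes_meet _ _ _ _ _ cd).
move=> [A1 [z1 [xi1 [A2 [z2 [xi2 [K1 K2 e1 e2 e3]]]]]]].
have x0 : 0 < l * (t - s) by rewrite mulr_gt0// subr_gt0.
have q1 : 1 < expR (l * (t - s)) by rewrite expR_gt1.
apply: (crooked_coord_separated k0 q1 _ K1 K2 e1 e2 e3).
have := tanh_lt x0; set q := expR _ in q1 *.
(* With [x = l * (t - s)] the translation is [mu * x]; the required bound is [tanh_lt] multiplied by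
   [mu], combined with [k <= mu]. *)
have -> : alpha * (t - s) = alpha / l * (l * (t - s)) by field; rewrite gt_eqF.
set x := l * (t - s) in x0 *; move: kmu; set mu := alpha / l => kmu T.
have mu0 : 0 < mu by exact: lt_le_trans kmu.
apply: (@le_lt_trans _ _ (mu * (2 * (q - 1)))).
  rewrite (mulrC 2 k) -mulrA ler_wpM2r//; lra.
by rewrite -mulrA ltr_pM2l.
Qed.

(** The common point lies on both stems: for [A1 = A2 = 0] the linear equations determine [z1] and
    [z2], and it remains to fit [xi1] and [xi2]. Only the product [a * b] is prescribed, so every
    director is covered. *)
Lemma crooked_planes_meet_of_lt (k a b c d : R) (o : V) : alpha / l < k ->
  2 * (c * d * ldot gm gp) = 1 -> a * b = k ^+ 2 ->
  exists2 t, 0 != t &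
    crooked_plane (frame_orbit o (a * c) (b * d) 0) (frame_director c d 0) `&`
    crooked_plane (frame_orbit o (a * c) (b * d) t) (frame_director c d t) !=set0.
Proof.
move=> kmu cd ab; set mu := alpha / l in kmu.
have mu0 : 0 < mu by rewrite divr_gt0.
have k0 : 0 < k by exact: lt_trans kmu.
(* For this [x] one has [mu * (2 + x) = 2 * k], which turns [tanh_ge] into [muk]. *)
pose x := 2 * (k / mu - 1).
have x0 : 0 < x.
  have : 1 < k / mu by rewrite ltr_pdivlMr// mul1r.
  by rewrite /x; lra.
exists (x / l); first by rewrite lt_eqF// divr_gt0.
apply/(crooked_planes_meet _ _ _ _ _ cd); rewrite subr0.
have -> : l * (x / l) = x by field; rewrite gt_eqF.
have -> : alpha * (x / l) = mu * x by rewrite /mu; field; rewrite gt_eqF.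
set q := expR x; have q1 : 1 < q by rewrite expR_gt1.
have q1' : 0 < q + 1 by lra.
pose z1 := (a * q - b) / (q + 1); pose z2 := (a - b * q) / (q + 1).
have zz : z1 - z2 = (a + b) * (q - 1) / (q + 1).
  by rewrite /z1 /z2; field; rewrite gt_eqF.
have muk : mu * x * (q + 1) <= 2 * k * (q - 1).
  have := tanh_ge (ltW x0); rewrite -/q -(ler_pM2l mu0) mulrA => H.
  apply: le_trans H _.
  by have -> : mu * ((2 + x) * (q - 1)) = 2 * k * (q - 1) by rewrite /x; field; rewrite gt_eqF.
clearbody x mu.
(* The arithmetic-geometric mean inequality for [a * b = k ^+ 2], squared since [a] and [b] may be
   negative. *)
have ab0 : (2 * k) ^+ 2 <= (a + b) ^+ 2.
  rewrite -subr_ge0; have -> : (a + b) ^+ 2 - (2 * k) ^+ 2 = (a - b) ^+ 2.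
    by rewrite exprMn -ab; ring.
  exact: sqr_ge0.
have Dz : (mu * x) ^+ 2 <= (z1 - z2) ^+ 2.
  rewrite zz expr_div_n ler_pdivlMr ?exprn_gt0// -exprMn.
  apply: (@le_trans _ _ ((2 * k * (q - 1)) ^+ 2)).
    have p0 : 0 <= mu * x * (q + 1) by apply: ltW; rewrite !mulr_gt0.
    by rewrite ler_pXn2r ?nnegrE //; apply: le_trans p0 _.
  rewrite [leLHS]exprMn [leRHS]exprMn.
  by apply: ler_wpM2r => //; exact: sqr_ge0.
have z0 : z1 - z2 != 0.
  apply/eqP => z0; move: Dz; rewrite z0 expr0n/= leNgt => /negP; apply.
  by rewrite exprn_gt0// mulr_gt0.
(* Taking [xi = r * z] on both stems with one common ratio gives the required difference, and
   [r ^+ 2 <= 1] keeps both points in the stems. *)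
pose r := mu * x / (z1 - z2).
have r1 : r ^+ 2 <= 1 by rewrite /r expr_div_n ler_pdivrMr ?mul1r// exprn_even_gt0.
have rz (z : R) : crooked_coord 0 z (r * z).
  apply: Or33; split=> //; rewrite exprMn -[leRHS]mul1r.
  by apply: ler_wpM2r => //; exact: sqr_ge0.
exists 0, z1, (r * z1), 0, z2, (r * z2); split => //.
- by rewrite /z1 /z2; field; rewrite gt_eqF.
- by rewrite /z1 /z2; field; rewrite gt_eqF.
- by rewrite -mulrBr divfK.
Qed.

End Orbit.

(** * Reduction of a hyperbolic group to its normal form *)

Section HyperbolicGroup.
Variable R : realType.
Local Notation V := 'cV[R]_3.

(** The isometry both preserves [ldot x y] and multiplies it by [a * b]. *)
Lemma ldot_eigen (g : 'M[R]_3) (x y : V) (a b : R) :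
  (forall x y : V, ldot (g *m x) (g *m y) = ldot x y) ->
  g *m x = a *: x -> g *m y = b *: y -> a * b != 1 -> ldot x y = 0.
Proof.
move=> iso gx gy ab; have := iso x y; rewrite gx gy ldotZl ldotZr => E.
have /eqP : (a * b - 1) * ldot x y = 0 by rewrite mulrBl mul1r -mulrA E subrr.
by rewrite mulf_eq0 subr_eq0 (negbTE ab) => /eqP.
Qed.

Lemma lorentz_frame_of_hyperbolic (f : affine_map R) (l : R) (gm gp g0 : V) :
  orientation_preserving_isometry f -> hyperbolic_frame (lin f) l gm gp g0 ->
  lorentz_frame gm gp g0.
Proof.
move=> [iso _] [l0 [gmE m2] [gpE p2] [g0E u0] d].
have g0E' : lin f *m g0 = 1 *: g0 by rewrite scale1r.
split => //; [split => //|split => //|split].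
- apply: (ldot_eigen iso gmE gmE); rewrite -expRD lt_eqF// expR_lt1; lra.
- apply: (ldot_eigen iso gpE gpE); rewrite -expRD gt_eqF// expR_gt1; lra.
- apply: (ldot_eigen iso g0E' gmE); rewrite mul1r lt_eqF// expR_lt1; lra.
- apply: (ldot_eigen iso g0E' gpE); rewrite mul1r gt_eqF// expR_gt1; lra.
Qed.

Section Generator.
Variables (gamma : R -> affine_map R) (A : 'M[R]_3) (b : V).
Hypothesis gammaE : forall t : R,
  homogeneous (gamma t) = @expmx R 3 (t *: block_mx A b 0 0).

(** The last coordinate is 1 for points, which are translated, and 0 for vectors, which are not. *)
Lemma homogeneous_mul (f : affine_map R) (v : V) (c : 'cV[R]_1) :
  homogeneous f *m col_mx v c = col_mx (lin f *m v + trans f *m c) c.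
Proof. by rewrite mul_block_col mul0mx add0r mul1mx. Qed.

Lemma lin_generator_eigen (v : V) (c t : R) : A *m v = c *: v ->
  lin (gamma t) *m v = expR (t * c) *: v.
Proof.
move=> Av; have H : (t *: block_mx A b 0 0) *m col_mx v 0 = (t * c) *: col_mx v (0 : 'cV[R]_1).
  rewrite -scalemxAl mul_block_col !mul0mx mulmx0 !addr0 Av.
  by rewrite !scale_col_mx !scaler0 scalerA.
have : homogeneous (gamma t) *m col_mx v 0 = expR (t * c) *: col_mx v (0 : 'cV[R]_1).
  by rewrite gammaE; exact: (@expmx_eigen R 3).
by rewrite homogeneous_mul mulmx0 addr0 scale_col_mx => /eq_col_mx [].
Qed.

Lemma act_generator (o v : V) (t : R) : A *m o + b = v -> A *m v = 0 ->
  act (gamma t) o = o + t *: v.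
Proof.
move=> Ao Av.
have H1 : (t *: block_mx A b 0 0) *m col_mx o 1%:M = col_mx (t *: v) (0 : 'cV[R]_1).
  by rewrite -scalemxAl mul_block_col !mul0mx mulmx1 addr0 Ao scale_col_mx scaler0.
have H2 : (t *: block_mx A b 0 0) *m col_mx (t *: v) (0 : 'cV[R]_1) = col_mx (0 : V) (0 : 'cV[R]_1).
  rewrite -scalemxAl mul_block_col !mul0mx mulmx0 !addr0 -scalemxAr Av scaler0.
  by rewrite scale_col_mx !scaler0.
have : homogeneous (gamma t) *m col_mx o 1%:M = col_mx o 1%:M + col_mx (t *: v) (0 : 'cV[R]_1).
  by rewrite gammaE -H1; apply: (@expmx_square_zero R 3); rewrite H1 H2 col_mx0.
by rewrite homogeneous_mul mulmx1 add_col_mx addr0 => /eq_col_mx [].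
Qed.

Lemma generator_comm : A *m lin (gamma 1) = lin (gamma 1) *m A.
Proof.
have : block_mx A b (0 : 'M[R]_(1, 3)) (0 : 'M[R]_1) *m homogeneous (gamma 1) =
    homogeneous (gamma 1) *m block_mx A b (0 : 'M[R]_(1, 3)) (0 : 'M[R]_1).
  by rewrite gammaE scale1r; exact: (@expmx_comm R 3).
rewrite !mulmx_block => /eq_block_mx [] + _ _ _.
by rewrite !mulmx0 !addr0.
Qed.

End Generator.

Lemma act_add (f : affine_map R) (p v : V) : act f (p + v) = act f p + lin f *m v.
Proof. by rewrite /act mulmxDr addrAC. Qed.

(** The data concern [gamma 1] alone. The generator [A] commutes with its linear part, whose
    eigenvalues are distinct, so [A] is diagonal in the same frame; injectivity of the exponential
    gives its eigenvalues [- l], [l] and 0. *)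
Lemma hyperbolic_group_normal_form (gamma : R -> affine_map R) (l alpha : R) (gm gp g0 : V) :
  one_parameter_hyperbolic_group gamma ->
  hyperbolic_frame (lin (gamma 1)) l gm gp g0 ->
  is_margulis_invariant (gamma 1) g0 alpha ->
  exists o : V, forall t : R,
    [/\ lin (gamma t) *m gm = expR (t * - l) *: gm,
        lin (gamma t) *m gp = expR (t * l) *: gp,
        lin (gamma t) *m g0 = g0 &
        act (gamma t) o = o + t *: (alpha *: g0)].
Proof.
move=> [[A [b gammaE]] iso _] hyp [p' margulis].
have F := lorentz_frame_of_hyperbolic (iso 1) hyp.
have [l0 [gmE _] [gpE _] [g0E _] _] := hyp.
have comm := generator_comm gammaE; set g := lin (gamma 1) in gmE gpE g0E comm margulis hyp.
have em : expR (- l) < 1 by rewrite expR_lt1; lra.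
have ep : 1 < expR l by rewrite expR_gt1.
have gA (v : V) (c : R) : g *m v = c *: v -> g *m (A *m v) = c *: (A *m v).
  by move=> gv; rewrite mulmxA -comm -mulmxA gv -scalemxAr.
have gE (x y z : R) : g *m (x *: gm + y *: gp + z *: g0) =
    (x * expR (- l)) *: gm + (y * expR l) *: gp + z *: g0.
  by rewrite !mulmxDr -!scalemxAr gmE gpE g0E !scalerA.
have coordA (v : V) (c : R) : g *m v = c *: v -> exists x y z,
    [/\ A *m v = x *: gm + y *: gp + z *: g0, x * (expR (- l) - c) = 0,
        y * (expR l - c) = 0 & z * (1 - c) = 0].
  move=> /gA; have [x [y [z ->]]] := frame_coord F (A *m v).
  rewrite gE !scalerDr !scalerA => /(frame_coord_inj F) [e1 e2 e3].
  by exists x, y, z; split=> //; lra.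
have lin1 (v : V) (c d : R) : A *m v = d *: v -> g *m v = c *: v -> v != 0 -> expR d = c.
  move=> Av gv v0; have := lin_generator_eigen gammaE 1 Av.
  rewrite -/g gv mul1r => /eqP; rewrite -subr_eq0 -scalerBl scaler_eq0 (negbTE v0) orbF.
  by rewrite subr_eq0 => /eqP ->.
have [[mm m2] [pp p2] g00 _ _] := F.
have third0 (v : V) : v 2 0 = 1 -> v != 0.
  by move=> v2; apply/eqP => v0; move: v2; rewrite v0 mxE; lra.
have g00' : g0 != 0 by apply/eqP => v0; move: g00; rewrite v0 /ldot !mxE; lra.
have neq := (gt_eqF em, gt_eqF ep, lt_eqF em, lt_eqF ep,
  gt_eqF (lt_trans em ep), lt_eqF (lt_trans em ep)).
have Am : A *m gm = (- l) *: gm.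
  have [x [y [z [AE _ /eqP + /eqP]]]] := coordA gm _ gmE.
  rewrite !mulf_eq0 !subr_eq0 !neq !orbF => /eqP y0 /eqP z0.
  rewrite y0 z0 !scale0r !addr0 in AE.
  by rewrite AE; congr (_ *: _); apply: expR_inj; exact: lin1 AE gmE (third0 _ m2).
have Ap : A *m gp = l *: gp.
  have [x [y [z [AE /eqP + _ /eqP]]]] := coordA gp _ gpE.
  rewrite !mulf_eq0 !subr_eq0 !neq !orbF => /eqP x0 /eqP z0.
  rewrite x0 z0 !scale0r addr0 add0r in AE.
  by rewrite AE; congr (_ *: _); apply: expR_inj; exact: lin1 AE gpE (third0 _ p2).
have A0 : A *m g0 = 0 *: g0.
  have g0E' : g *m g0 = 1 *: g0 by rewrite scale1r.
  have [x [y [z [AE /eqP + /eqP + _]]]] := coordA g0 _ g0E'.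
  rewrite !mulf_eq0 !subr_eq0 (lt_eqF em) (gt_eqF ep) !orbF => /eqP x0 /eqP y0.
  rewrite x0 y0 !scale0r !add0r in AE.
  rewrite AE; congr (_ *: _); apply: expR_inj; rewrite expR0.
  exact: lin1 AE g0E' g00'.
have [x [y [z bE]]] := frame_coord F b.
(* [A] is invertible on the span of [gm] and [gp]; this [o] cancels the components of [b] there. *)
pose o := (x / l) *: gm - (y / l) *: gp.
have Ao : A *m o + b = z *: g0.
  rewrite /o mulmxBr -!scalemxAr Am Ap bE; apply: cV3P; rewrite !mxE; field;
    by rewrite gt_eqF.
have Az : A *m (z *: g0) = 0 by rewrite -scalemxAr A0 scale0r scaler0.
have actE t := act_generator gammaE t Ao Az.
suff za : z = alpha.
  exists o => t; rewrite actE za; split => //.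
  - exact: (lin_generator_eigen gammaE t Am).
  - exact: (lin_generator_eigen gammaE t Ap).
  - by rewrite (lin_generator_eigen gammaE t A0) mulr0 expR0 scale1r.
(* Displacements of all points under [gamma 1] have the same [g0] component, because the linear part
   fixes [g0]; comparing [p'] with [o] identifies [z]. *)
have [x' [y' [z' oE]]] := frame_coord F (p' - o).
have pE : p' = o + (x' *: gm + y' *: gp + z' *: g0) by rewrite -oE addrC subrK.
have := margulis; rewrite pE act_add actE -/g gE => E.
have : (x' * (expR (- l) - 1)) *: gm + (y' * (expR l - 1)) *: gp + z *: g0 =
    0 *: gm + 0 *: gp + alpha *: g0.
  rewrite !scale0r !add0r -E; apply: cV3P; rewrite !mxE; ring.
by move=> /(frame_coord_inj F) [].
Qed.

(** The direction [v] of the line is an eigenvector of the linear part, and displacements along the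
    line are multiples of [v] with nonzero [g0] component [alpha]. Hence [v] is parallel to [g0],
    and a displacement along [g0] forces [q] onto the axis through [o]. *)
Lemma invariant_line_sub (f : affine_map R) (l alpha : R) (gm gp g0 o q : V) (L : set V) :
  lorentz_frame gm gp g0 -> hyperbolic_frame (lin f) l gm gp g0 ->
  act f o = o + alpha *: g0 -> alpha != 0 -> invariant_line f L -> L q ->
  exists s, q = o + s *: g0.
Proof.
move=> F [l0 [gmE _] [gpE _] [g0E _] _] fo alpha0 [[p0 [v [v0 LE]]] fL] Lq.
have em : expR (- l) < 1 by rewrite expR_lt1; lra.
have ep : 1 < expR l by rewrite expR_gt1.
have gE (x y z : R) : lin f *m (x *: gm + y *: gp + z *: g0) =
    (x * expR (- l)) *: gm + (y * expR l) *: gp + z *: g0.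
  by rewrite !mulmxDr -!scalemxAr gmE gpE g0E !scalerA.
have diff p p' : L p -> L p' -> exists r : R, p' - p = r *: v.
  rewrite LE => -[s _ <-] [s' _ <-]; exists (s' - s).
  by apply: cV3P; rewrite !mxE; ring.
have Lf p : L p -> L (act f p) by move=> Lp; rewrite -fL; exists p.
have Lqv : L (q + v).
  by move: Lq; rewrite LE => -[s _ <-]; exists (s + 1) => //; rewrite scalerDl scale1r addrA.
have [r rE] := diff _ _ Lq (Lf _ Lq).
have [r' r'E] := diff _ _ (Lf _ Lq) (Lf _ Lqv).
have [x [y [z vE]]] := frame_coord F v.
have [a [b [c qE]]] := frame_coord F (q - o).
rewrite act_add addrAC subrr add0r vE gE !scalerDr !scalerA in r'E.
have [e1 e2 e3] := frame_coord_inj F r'E.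
have {}qE : q = o + (a *: gm + b *: gp + c *: g0) by rewrite -qE addrC subrK.
have := rE; rewrite qE act_add fo gE vE !scalerDr !scalerA => E.
have : (a * (expR (- l) - 1)) *: gm + (b * (expR l - 1)) *: gp + alpha *: g0 =
    (r * x) *: gm + (r * y) *: gp + (r * z) *: g0.
  by rewrite -E; apply: cV3P; rewrite !mxE; ring.
move=> /(frame_coord_inj F) [h1 h2 h3].
have z0 : z != 0 by apply: contraNneq alpha0 => z0; rewrite h3 z0 mulr0.
have r'1 : r' = 1 by apply: (mulIf z0); rewrite mul1r.
have x0 : x = 0.
  have /eqP : x * (expR (- l) - 1) = 0 by rewrite mulrBr e1 r'1; ring.
  by rewrite mulf_eq0 subr_eq0 (lt_eqF em) orbF => /eqP.
have y0 : y = 0.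
  have /eqP : y * (expR l - 1) = 0 by rewrite mulrBr e2 r'1; ring.
  by rewrite mulf_eq0 subr_eq0 (gt_eqF ep) orbF => /eqP.
move: h1 h2; rewrite x0 y0 !mulr0 => /eqP + /eqP.
rewrite !mulf_eq0 !subr_eq0 (lt_eqF em) (gt_eqF ep) !orbF => /eqP a0 /eqP b0.
by exists c; rewrite a0 b0 !scale0r !add0r.
Qed.

Lemma perp_frame_coord (gm gp g0 x : V) : lorentz_frame gm gp g0 -> perp g0 x ->
  exists a b, x = a *: gm + b *: gp /\ ldot x x = 2 * (a * b * ldot gm gp).
Proof.
move=> F; have [[mm _] [pp _] g00 [g0m g0p] _] := F.
rewrite /perp/=; have [a [b [c ->]]] := frame_coord F x.
rewrite !ldotE g00 (ldotC gm g0) (ldotC gp g0) g0m g0p => xg0.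
have -> : c = 0 by lra.
exists a, b; rewrite scale0r addr0; split=> //.
by rewrite mm pp (ldotC gp gm); ring.
Qed.

End HyperbolicGroup.

(** * The criterion for the existence of the foliation *)

Unset Implicit Arguments.
Set Strict Implicit.

Theorem theorem4p4 (R : realType) (gamma : R -> affine_map R)
    (l alpha mu k : R) (gm gp g0 : 'cV[R]_3) (L : set 'cV[R]_3) (p : 'cV[R]_3)
    (Hgamma : one_parameter_hyperbolic_group gamma)
    (Hframe : hyperbolic_frame (lin (gamma 1)) l gm gp g0)
    (Halpha : is_margulis_invariant (gamma 1) g0 alpha)
    (alpha_gt0 : 0 < alpha)
    (Hmu : mu = generalized_margulis_invariant alpha l)
    (HL : invariant_line (gamma 1) L)
    (k_gt0 : 0 < k)
    (Hp : hyperboloid L g0 k p) :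
  admits_crooked_foliation gamma g0 p <-> k <= mu.
Proof.
have [base gammaE] := hyperbolic_group_normal_form Hgamma Hframe Halpha.
have [_ iso _] := Hgamma.
have F := lorentz_frame_of_hyperbolic (iso 1) Hframe.
have [l0 _ _ _ _] := Hframe; have m0 := ldot_frame_lt0 F.
have act1 : act (gamma 1) base = base + alpha *: g0.
  by have [_ _ _ ->] := gammaE 1; rewrite scale1r.
have [q [x [Lq xg0 pE xx]]] := Hp.
have [s qE] := invariant_line_sub F Hframe act1 (lt0r_neq0 alpha_gt0) HL Lq.
have [a [b [xE xx']]] := perp_frame_coord F xg0.
have ab : 2 * (a * b * ldot gm gp) = k ^+ 2 by rewrite -xx' xx.
have orbitE : (fun t => act (gamma t) p) = frame_orbit gm gp g0 l alpha (base + s *: g0) a b.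
  apply/funext => t; have [gmE gpE g0E baseE] := gammaE t.
  rewrite pE qE xE !act_add baseE mulmxDr -!scalemxAr gmE gpE g0E.
  by apply: cV3P; rewrite !mxE; ring.
have directorE c d : (fun t => lin (gamma t) *m (c *: gm + d *: gp)) =
    frame_director gm gp l c d.
  apply/funext => t; have [gmE gpE _ _] := gammaE t.
  by rewrite frame_directorE mulmxDr -!scalemxAr gmE gpE !scalerA.
rewrite Hmu /generalized_margulis_invariant; split.
  move=> [u [uu ug0]]; have [c [d [uE cd]]] := perp_frame_coord F ug0.
  rewrite uu in cd; rewrite uE orbitE directorE => -[_ _ _ disj].
  rewrite leNgt; apply/negP => kmu.
  have c0 : c != 0 by apply/eqP => c0; move: cd; rewrite c0; lra.
  have d0 : d != 0 by apply/eqP => d0; move: cd; rewrite d0; lra.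
  (* The vertex component has square [k ^+ 2] and the director square 1; the quotient of the two
     squares is the product of the coordinate ratios. *)
  have abk : a / c * (b / d) = k ^+ 2.
    have -> : a / c * (b / d) = (2 * (a * b * ldot gm gp)) / (2 * (c * d * ldot gm gp)).
      by field; rewrite c0 d0 (lt_eqF m0).
    by rewrite ab -cd divr1.
  have [t t0] := crooked_planes_meet_of_lt F l0 alpha_gt0 (base + s *: g0) kmu (esym cd) abk.
  by rewrite !divfK// (disj _ _ t0) => -[].
move=> kmu; have k0 : k != 0 by rewrite gt_eqF.
(* The director is the [g0]-orthogonal component [x] of [p] divided by [k], a unit vector because
   [ldot x x = k ^+ 2]. *)
have cd : 2 * (a / k * (b / k) * ldot gm gp) = 1.
  have -> : 2 * (a / k * (b / k) * ldot gm gp) = 2 * (a * b * ldot gm gp) / k ^+ 2.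
    by field; rewrite k0.
  by rewrite ab divff// expf_neq0.
exists ((a / k) *: gm + (b / k) *: gp); split.
- have [[mm _] [pp _] _ _ _] := F.
  by rewrite /unit_spacelike !ldotE mm pp (ldotC gp gm); lra.
- have [_ _ _ [g0m g0p] _] := F.
  by rewrite /perp/= !ldotE (ldotC gm g0) (ldotC gp g0) g0m g0p; ring.
rewrite orbitE directorE.
have := foliation_of_le F l0 alpha_gt0 (base + s *: g0) k_gt0 kmu cd.
by rewrite ![k * _]mulrC !divfK.
Qed.
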